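(* Let $p > 2$ be real. For $X \ge 1$ sufficiently large, let $\tau(n) = \sum_{d \mid n} 1$ denote the number of positive divisors of $n$, and let \[M_\tau(\alpha) = \sum_{n \le X} \tau(n) e(n\alpha), \qquad e(\alpha) = e^{2\pi i \alpha}.\] Then \[X^{p-1}(\log X)^p \ll \int_0^1 |M_\tau(\alpha)|^p \, d\alpha \ll X^{p-1}(\log X)^p,\] where the implied constants depend only on $p$.
   Context: The sum over $n \le X$ ranges over positive integers $n$ with $n \le X$. The notation $f \ll g$ means $|f| \le C g$ for a constant $C>0$. *)

(* Defs.v *)
From mathcomp Require Import all_boot all_order all_algebra.
From mathcomp Require Import all_classical all_reals all_analysis.
From mathcomp Require Import complex.

Set Implicit Arguments.
Unset Strict Implicit.
Unset Printing Implicit Defensive.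

Import Order.TTheory GRing.Theory Num.Theory.
Import numFieldNormedType.Exports.

Local Open Scope ring_scope.
Local Open Scope complex_scope.

Definition tau (n : nat) : nat := size (divisors n).

(* e(a) = exp(2 pi i a), written out by Euler's formula because the library has
   no complex exponential. *)
Definition e {R : realType} (a : R) : R[i] :=
  cos (2 * pi * a) +i* sin (2 * pi * a).

(* For X >= 0, n <= Num.truncn X iff n%:R <= X (truncn_ge_nat), so n runs over
   the positive integers n <= X. *)
Definition M_tau {R : realType} (X a : R) : R[i] :=
  \sum_(1 <= n < (Num.truncn X).+1) (tau n)%:R * e (n%:R * a).

(* The library norm `|z| of z : R[i] lies in R[i]; this is the modulus as an
   element of R. *)
Definition cabs {R : realType} (z : R[i]) : R := ComplexField.Normc.normc z.

(* Main.v *)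
(* Lower bound: for 0 <= a <= 1/(16 X) all the e(n a), n <= X, are within 1/2 of
   1, so |M(a)| >= (1/2) sum tau(n) >> X log X on an interval of length >> 1/X.

   Upper bound: let N and D be the integer parts of X and sqrt X. By the
   hyperbola method M(a) is a sum over d <= D of geometric sums of ratio e(d a)
   and length at most N/d, so |M(a)| << sum_(d <= D) min(N/d, 1/|e(d a) - 1|).
   By Dirichlet a = b/q + t with q <= 16 D, (b, q) = 1 and |t| <= 1/(16 q D).
   The multiples d of q contribute << (log X / q) min(N, 1/|t|). For the other d
   the perturbation t is harmless, |e(d a) - 1| >> |e(d b/q) - 1|, and since
   b is invertible mod q they contribute << (D + q) log q << D log X. Hence
   |M(a)|^p << (log X)^p (sum_(q, b) q^-p min(N, 1/|a - b/q|)^p + D^p) for every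
   a in [0, 1], with no minor arcs left over. Integrating, each (q, b) gives
   << q^-p N^(p-1), and as p > 2 the sum of q^(1-p) converges and D^p <= X^(p-1). *)

Require Import Defs.
From mathcomp Require Import all_boot all_order all_algebra.
From mathcomp Require Import all_classical all_reals all_analysis.
From mathcomp Require Import complex measurable_realfun ring lra zify.

Import Order.TTheory GRing.Theory Num.Theory.
Import numFieldNormedType.Exports.

Local Open Scope classical_set_scope.
Local Open Scope ring_scope.

Set Implicit Arguments.
Unset Strict Implicit.
Unset Printing Implicit Defensive.

(** * The modulus and the additive character *)

Lemma cabs_ge0 (R : realType) (z : R[i]) : 0 <= cabs z.
Proof. by case: z => a b; exact: sqrtr_ge0. Qed.

Lemma cabsD (R : realType) (z w : R[i]) : cabs (z + w) <= cabs z + cabs w.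
Proof. exact: (@le_normcD R). Qed.

Lemma cabsM (R : realType) (z w : R[i]) : cabs (z * w) = cabs z * cabs w.
Proof. exact: ComplexField.Normc.normcM. Qed.

Lemma cabsN (R : realType) (z : R[i]) : cabs (- z) = cabs z.
Proof. exact: (@normcN R). Qed.

Lemma cabsB (R : realType) (z w : R[i]) : cabs (z - w) <= cabs z + cabs w.
Proof. by rewrite -(cabsN w) cabsD. Qed.

Lemma cabs_nat (R : realType) (n : nat) : cabs (n%:R : R[i]) = n%:R.
Proof.
rewrite -[n%:R in LHS](rmorph_nat (real_complex R)) /cabs /=.
by rewrite expr0n addr0 sqrtr_sqr ger0_norm.
Qed.

Lemma cabs_sum (R : realType) (I : Type) (r : seq I) (P : pred I)
    (F : I -> R[i]) :
  cabs (\sum_(i <- r | P i) F i) <= \sum_(i <- r | P i) cabs (F i).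
Proof.
elim/big_ind2: _ => [|x1 x2 y1 y2 h1 h2|//].
  by rewrite (cabs_nat R 0).
exact: le_trans (cabsD _ _) (lerD h1 h2).
Qed.

Lemma eD (R : realType) (a b : R) : e (a + b) = e a * e b.
Proof.
rewrite /e mulrDr cosD sinD; congr (_ +i* _)%C.
by rewrite addrC [sin _ * _]mulrC.
Qed.

Lemma e0 (R : realType) : e (0 : R) = 1.
Proof. by rewrite /e mulr0 cos0 sin0. Qed.

Lemma e_nat (R : realType) (n : nat) : e (n%:R : R) = 1.
Proof.
elim: n => [|n IH]; first exact: e0.
rewrite -natr1 eD IH mul1r /e mulr1 mulr_natl.
by rewrite cos2pi sin2pi.
Qed.

Lemma cabs_e (R : realType) (a : R) : cabs (e a) = 1.
Proof. by rewrite /cabs /= cos2Dsin2 sqrtr1. Qed.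

(** * Chord lengths and geometric sums *)

(** Comparable to the distance from [a] to the nearest integer, which it replaces throughout:
    periodicity and subadditivity follow directly from the multiplicativity of [e]. *)
Definition chord {R : realType} (a : R) : R := cabs (e a - 1).

Lemma chord_ge0 (R : realType) (a : R) : 0 <= chord a.
Proof. exact: cabs_ge0. Qed.

Lemma chordE (R : realType) (a : R) : chord a = 2 * `|sin (pi * a)|.
Proof.
rewrite /chord /cabs /= subr0.
rewrite (_ : 2 * pi * a = (pi * a) *+ 2); last by rewrite -mulrA mulr_natl.
rewrite cos_mulr2n sin_mulr2n !mulr2n.
set c := cos _; set s := sin _.
have cs : c ^+ 2 = 1 - s ^+ 2 by rewrite /c /s cos2sin2.
have -> : (c ^+ 2 + c ^+ 2 - 1 - 1) ^+ 2 + (c * s + c * s) ^+ 2 = (2 * s) ^+ 2.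
  have -> : (c * s + c * s) ^+ 2 = 4 * c ^+ 2 * s ^+ 2 by ring.
  by rewrite cs; ring.
by rewrite sqrtr_sqr normrM ger0_norm.
Qed.

Lemma chordN (R : realType) (a : R) : chord (- a) = chord a.
Proof. by rewrite !chordE mulrN sinN normrN. Qed.

Lemma chord_addn (R : realType) (a : R) (n : nat) : chord (a + n%:R) = chord a.
Proof. by rewrite /chord eD e_nat mulr1. Qed.

Lemma chord_le_add (R : realType) (a b : R) : chord (a + b) <= chord a + chord b.
Proof.
rewrite /chord eD.
have -> : e a * e b - 1 = (e a - 1) * e b + (e b - 1) by ring.
by apply: le_trans (cabsD _ _) _; rewrite cabsM cabs_e mulr1.
Qed.

Lemma continuous_withinT (R : realType) (f : R -> R) (A : set R) :
  continuous f -> {within A, continuous f}.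
Proof. by move=> cf; apply: continuous_subspaceT. Qed.

Lemma sin_le_id (R : realType) (x : R) : 0 <= x -> sin x <= x.
Proof.
move=> x0.
have [c _] := MVT_segment x0 (fun y _ => is_derive_sin y)
  (@continuous_withinT _ _ _ (@continuous_sin R)).
by rewrite sin0 !subr0 => ->; rewrite ler_piMl// cos_le1.
Qed.

Lemma abs_sin_le (R : realType) (x : R) : `|sin x| <= `|x|.
Proof.
wlog x0 : x / 0 <= x => [h|].
  have [|/ltW] := leP 0 x; first exact: h.
  by rewrite -oppr_ge0 => /h; rewrite sinN !normrN.
rewrite (ger0_norm x0) ler_norml sin_le_id// andbT.
have [x1|x1] := leP 1 x; first by rewrite (le_trans _ (sin_geN1 x))// lerN2.
apply: (@le_trans _ _ 0); first by rewrite oppr_le0.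
apply: sin_ge0_pi; rewrite x0 /=.
by apply: le_trans (ltW x1) _; have := pi_ge2 R; lra.
Qed.

Lemma pi_le4 (R : realType) : pi <= 4 :> R.
Proof. by have [/andP[_]] := pihalf_02_cos_pihalf R; rewrite ler_pdivrMr// -natrM. Qed.

(** The constant 8 is [2 * 4], from [chord a = 2 |sin (pi a)|] and [pi <= 4]. *)
Lemma chord_le (R : realType) (a : R) : chord a <= 8 * `|a|.
Proof.
rewrite chordE; have := abs_sin_le (pi * a); rewrite normrM (ger0_norm (pi_ge0 R)).
have := ler_wpM2r (normr_ge0 a) (pi_le4 R); lra.
Qed.

(** The double angle stays in the first quadrant, where its cosine [2 cos^2 y - 1] is
    nonnegative. *)
Lemma cos_sqr_ge_half (R : realType) (y : R) :
  0 <= y <= pi / 4 -> 0 <= cos y /\ 2^-1 <= cos y ^+ 2.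
Proof.
have p0 := pi_gt0 R; move=> /andP[y0 y4]; split.
  by apply: cos_ge0_pihalf; apply/andP; split; lra.
have : 0 <= cos (y *+ 2) 
    by apply: cos_ge0_pihalf; rewrite (mulr2n y); apply/andP; split; lra.
rewrite cos_mulr2n (mulr2n (cos y ^+ 2)); lra.
Qed.

(** With [y = x / 2], angle doubling and the mean value theorem give [sin x = x * cos c * cos y] for
    some [c] in [[0, y]], and both cosines have square at least 1/2. *)
Lemma sin_ge_half (R : realType) (x : R) : 0 <= x <= pi / 2 -> x / 2 <= sin x.
Proof.
move=> /andP[x0 xp]; set y := x / 2.
have y0 : 0 <= y by rewrite /y; lra.
have xE : x = y *+ 2 by rewrite /y (mulr2n (x / 2)); lra.
have [c cin] := MVT_segment y0 (fun y _ => is_derive_sin y)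
  (@continuous_withinT _ _ _ (@continuous_sin R)).
move: cin; rewrite in_itv /= => /andP[c0 cy].
rewrite sin0 !subr0 xE sin_mulr2n => ->.
have [|cc0 cc] := @cos_sqr_ge_half R c; first by rewrite /y in cy *; apply/andP; split; lra.
have [|cy0 cyy] := @cos_sqr_ge_half R y; first by rewrite /y in cy *; apply/andP; split; lra.
have h : 2^-1 <= cos y * cos c.
  rewrite -(@ler_pXn2r _ 2) ?nnegrE ?mulr_ge0 ?invr_ge0//.
  rewrite exprMn; move: cc cyy; set u := cos c ^+ 2; set v := cos y ^+ 2.
  by move=> hu hv; rewrite expr2; apply: ler_pM => //; lra.
rewrite (mulr2n (cos y * _)) mulrA; nra.
Qed.

Lemma chord_ge (R : realType) (a : R) : `|a| <= 2^-1 -> 2 * `|a| <= chord a.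
Proof.
wlog a0 : a / 0 <= a => [h|].
  have [|/ltW] := leP 0 a; first exact: h.
  by rewrite -oppr_ge0 => /h; rewrite normrN chordN.
rewrite (ger0_norm a0) chordE => a2.
have p0 := pi_gt0 R; have p2 := pi_ge2 R.
have h : pi * a / 2 <= sin (pi * a) by apply: sin_ge_half; apply/andP; split; nra.
have := ler_norm (sin (pi * a)); nra.
Qed.

(* The geometric sum is [(e (n t) - e (m t)) / (e t - 1)]. *)
Lemma cabs_geometric_chord (R : realType) (t : R) (m n : nat) :
  cabs (\sum_(m <= i < n) e (i%:R * t)) * chord t <= 2.
Proof.
have [nm|/ltnW mn] := leqP n m; first by rewrite big_geq// (cabs_nat R 0) mul0r.
rewrite /chord -cabsM.
rewrite mulr_suml.
have -> : \sum_(m <= i < n) e (i%:R * t) * (e t - 1)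
          = \sum_(m <= i < n) (e (i.+1%:R * t) - e (i%:R * t)).
  by apply: eq_bigr => i _; rewrite -natr1 mulrDl mul1r eD mulrBr mulr1.
rewrite (telescope_sumr (fun i => e (i%:R * t)))//.
by apply: le_trans (cabsB _ _) _; rewrite !cabs_e.
Qed.

Lemma cabs_geometric_size (R : realType) (t : R) (m n : nat) :
  cabs (\sum_(m <= i < n) e (i%:R * t)) <= (n - m)%:R.
Proof.
apply: le_trans (cabs_sum _ _ _) _.
by under eq_bigr do rewrite cabs_e; rewrite sumr_const_nat.
Qed.

(** * The divisor function and the hyperbola method *)

(** Counting up to a common [N] makes the range of candidate divisors independent of [n], so that
    the sums over [n] and [d] can be exchanged. *)
Lemma tau_count (n N : nat) : (0 < n <= N)%N ->
  tau n = count (dvdn^~ n) (index_iota 1 N.+1).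
Proof.
move=> /andP[n0 nN]; rewrite /tau -size_filter; apply: perm_size.
apply: uniq_perm; rewrite ?divisors_uniq ?filter_uniq ?iota_uniq// => d.
rewrite mem_filter mem_index_iota -dvdn_divisors//.
case dn: (d %| n)%N => //=; symmetry; apply/andP; split.
  exact: dvdn_gt0 dn.
by rewrite ltnS (leq_trans _ nN)// dvdn_leq.
Qed.

Lemma sum_multiples (V : nmodType) (f : nat -> V) (d N : nat) : (0 < d)%N ->
  \sum_(1 <= n < N.+1 | (d %| n)%N) f n
  = \sum_(1 <= m < N.+1 | (d * m <= N)%N) f (d * m)%N.
Proof.
move=> d0; rewrite -big_filter -[RHS]big_filter -(big_map (muln d) predT f).
apply: perm_big; apply: uniq_perm.
- by rewrite filter_uniq ?iota_uniq.
- rewrite map_inj_uniq ?filter_uniq ?iota_uniq//.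
  by move=> x y /eqP; rewrite eqn_pmul2l// => /eqP.
move=> n; rewrite mem_filter mem_index_iota; apply/idP/mapP.
  move=> /and3P[/dvdnP[m ->]]; rewrite muln_gt0 ltnS => /andP[m0 _] mN.
  exists m; last by rewrite mulnC.
  rewrite mem_filter mulnC mN mem_index_iota m0 ltnS /=.
  by rewrite (leq_trans _ mN)// leq_pmulr.
move=> [m]; rewrite mem_filter mem_index_iota => /and3P[mN m0 _] ->.
by rewrite dvdn_mulr//= muln_gt0 d0 m0 ltnS.
Qed.

(** The constraint [d * m <= N] is left symmetric for the hyperbola method. The weight [f] will be
    an exponential for the upper bound and the constant 1 for the lower bound. *)
Lemma sum_tau (V : pzRingType) (f : nat -> V) (N : nat) :
  \sum_(1 <= n < N.+1) (tau n)%:R * f n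
  = \sum_(1 <= d < N.+1) \sum_(1 <= m < N.+1 | (d * m <= N)%N) f (d * m)%N.
Proof.
transitivity (\sum_(1 <= n < N.+1) \sum_(1 <= d < N.+1 | (d %| n)%N) f n).
  apply: eq_big_nat => n nN; rewrite (@tau_count n N); last first.
    by rewrite -ltnS.
  by rewrite big_const_seq iter_addr_0 mulr_natl.
rewrite (exchange_big_dep_nat predT)//=.
by apply: eq_big_nat => d /andP[d0 _]; exact: sum_multiples.
Qed.

Lemma sum_pairs_le (V : nmodType) (f : nat -> V) (a d N : nat) : (0 < d)%N ->
  \sum_(a <= m < N.+1 | (d * m <= N)%N) f m = \sum_(a <= m < (N %/ d).+1) f m.
Proof.
move=> d0; rewrite [RHS](big_nat_widen _ _ N.+1) ?ltnS ?leq_div//.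
by apply: eq_bigl => m; rewrite ltnS leq_divRL// mulnC.
Qed.

(* Dirichlet's hyperbola method: in a pair with [d * m <= N < (D + 1)^2] either
   [d <= D], or [m <= D < d]. *)
Lemma hyperbola (V : nmodType) (f : nat -> V) (D N : nat) :
  (D <= N)%N -> (N < D.+1 ^ 2)%N ->
  \sum_(1 <= d < N.+1) \sum_(1 <= m < N.+1 | (d * m <= N)%N) f (d * m)%N
  = \sum_(1 <= d < D.+1) (\sum_(1 <= m < (N %/ d).+1) f (d * m)%N
                          + \sum_(D.+1 <= m < (N %/ d).+1) f (d * m)%N).
Proof.
move=> DN ND; rewrite (@big_cat_nat _ _ _ D.+1) ?ltnS//=.
rewrite [RHS]big_split /=; congr (_ + _).
  by apply: eq_big_nat => d /andP[d0 _]; rewrite sum_pairs_le.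
transitivity (\sum_(D.+1 <= d < N.+1) \sum_(1 <= m < D.+1 | (d * m <= N)%N) f (d * m)%N).
  apply: eq_big_nat => d /andP[Dd dN].
  rewrite [RHS](big_nat_widen _ _ N.+1)// [RHS]big_mkcond [LHS]big_mkcond.
  apply: eq_bigr => m _; case: ifP => //= dm; case: ifP => // /negbT.
  rewrite ltnS -ltnNge => Dm.
  have := leq_trans (leq_mul Dd Dm) dm.
  by rewrite mulnn leqNgt ND.
(* Exchanging the sums makes the small variable the outer one, as in the first half. *)
rewrite (exchange_big_dep_nat predT)//=; apply: eq_big_nat => m /andP[m0 _].
rewrite -sum_pairs_le//; apply: eq_big => [d|d _]; by rewrite mulnC.
Qed.

(** * Diophantine approximation *)

(** Pigeonhole: two of the [K + 1] fractional parts of [i * a], [i <= K], fall into the same one of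
    [K] boxes of length [1 / K]. The difference of their indices serves as denominator, and
    cancelling the gcd gives coprimality. *)
Lemma dirichlet_approximation (R : archiRealFieldType) (a : R) (K : nat) :
  (0 < K)%N -> 0 <= a <= 1 ->
  exists q b : nat, [/\ (0 < q <= K)%N, (b <= q)%N, coprime b q &
    `|a - b%:R / q%:R| <= (q%:R * K%:R)^-1].
Proof.
move=> K0 /andP[a0 a1]; have K0R : 0 < K%:R :> R by rewrite ltr0n.
pose t i := Num.truncn (i%:R * a).
pose x i := i%:R * a - (t i)%:R.
have x0 i : 0 <= x i by rewrite subr_ge0 truncn_le mulr_ge0.
have x1 i : x i < 1 by rewrite ltrBlDl natr1 truncnS_gt.
have box i : (Num.truncn (K%:R * x i) < K)%N.
  by rewrite truncn_lt_nat ?(mulr_ge0 (ltW K0R))// gtr_pMr.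
pose f (i : 'I_K.+1) := Ordinal (box i).
have /injectivePn[i0 [j0 ij0 fij0]] : ~~ injectiveb f.
  apply/negP => /injectiveP/leq_card; rewrite !card_ord ltnn; exact.
have [i [j [ij jK fij]]] : exists i j : nat, [/\ (i < j)%N, (j <= K)%N &
    Num.truncn (K%:R * x i) = Num.truncn (K%:R * x j)].
  have [ij|ji|/val_inj ij] := ltngtP i0 j0.
  - by exists i0, j0; split=> //; [rewrite -ltnS|have /(congr1 val) := fij0].
  - by exists j0, i0; split=> //; [rewrite -ltnS|have /(congr1 val) := fij0].
  - by rewrite ij eqxx in ij0.
pose m := (t j - t i)%N; pose n := (j - i)%N.
have n0 : (0 < n)%N by rewrite subn_gt0.
have n0R : 0 < n%:R :> R by rewrite ltr0n.
have mR : m%:R = (t j)%:R - (t i)%:R :> R.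
  by rewrite natrB// le_truncn// ler_wpM2r// ler_nat ltnW.
have nR : n%:R = j%:R - i%:R :> R by rewrite natrB// ltnW.
have close : `|n%:R * a - m%:R| <= K%:R^-1.
  rewrite -(ler_pM2l K0R) divff ?gt_eqF// -[X in X * _](gtr0_norm K0R) -normrM.
  have -> : K%:R * (n%:R * a - m%:R) = K%:R * x j - K%:R * x i.
    by rewrite mR nR /x; ring.
  have hi := @truncn_itv R _ (mulr_ge0 (ltW K0R) (x0 i)).
  have hj := @truncn_itv R _ (mulr_ge0 (ltW K0R) (x0 j)).
  move: hi hj; rewrite fij -natr1 => /andP[h1 h2] /andP[h3 h4].
  by rewrite ler_norml; apply/andP; split; lra.
(* [m] equals [n * a + x i - x j], which is less than [n + 1]; this keeps the fraction in
   [[0, 1]]. *)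
have mn : (m <= n)%N.
  rewrite -ltnS -(ltr_nat R) -natr1.
  move: close; rewrite ler_norml => /andP[h _].
  have na : n%:R * a <= n%:R by rewrite ler_piMr// ltW.
  rewrite mR; have := x0 i; have := x1 i; have := x0 j; have := x1 j.
  rewrite /x; rewrite nR in na *; lra.
have g0 : (0 < gcdn m n)%N by rewrite gcdn_gt0 n0 orbT.
have g0R : (gcdn m n)%:R != 0 :> R by rewrite pnatr_eq0 -lt0n.
pose b := (m %/ gcdn m n)%N; pose q := (n %/ gcdn m n)%N.
have mE : m = (b * gcdn m n)%N by rewrite divnK// dvdn_gcdl.
have nE : n = (q * gcdn m n)%N by rewrite divnK// dvdn_gcdr.
have q0 : (0 < q)%N by rewrite divn_gt0// dvdn_leq// dvdn_gcdr.
exists q, b; split.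
- rewrite q0 (leq_trans (leq_div _ _))// (leq_trans _ jK)// leq_subr//.
- exact: leq_div2r.
- rewrite /coprime -(eqn_pmul2r g0) mul1n muln_gcdl -mE -nE//.
have -> : b%:R / q%:R = m%:R / n%:R :> R.
  have -> : m%:R = b%:R * (gcdn m n)%:R :> R by rewrite -natrM -mE.
  have -> : n%:R = q%:R * (gcdn m n)%:R :> R by rewrite -natrM -nE.
  by rewrite -mulf_div divff// mulr1.
have -> : a - m%:R / n%:R = (n%:R * a - m%:R) / n%:R.
  by rewrite mulrBl mulrAC divff ?mul1r// gt_eqF.
rewrite normrM normfV (gtr0_norm n0R) ler_pdivrMr//.
(* Reduction only shrinks the denominator: [q <= n], so [1 / (n K) <= 1 / (q K)]. *)
apply: le_trans close _; rewrite invfM mulrAC ler_peMl// [leRHS]mulrC.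
by rewrite ler_pdivlMr ?ltr0n// mul1r ler_nat leq_div.
Qed.

(** * Sums of reciprocal chords at rationals *)

Definition harmonic_sum {R : realType} (n : nat) : R :=
  \sum_(1 <= k < n.+1) k%:R^-1.

Lemma harmonic_sum_ge0 (R : realType) (n : nat) : 0 <= harmonic_sum n :> R.
Proof. by apply: sumr_ge0 => k _; rewrite invr_ge0. Qed.

Lemma le_harmonic_sum (R : realType) (m n : nat) : (m <= n)%N ->
  harmonic_sum m <= harmonic_sum n :> R.
Proof.
move=> mn; rewrite /harmonic_sum [leRHS](@big_cat_nat _ _ _ m.+1)//= lerDl.
by apply: sumr_ge0 => k _; rewrite invr_ge0.
Qed.

(** [minn r (q - r) / q] is the distance from [r / q] to the nearest integer. The reflection
    [r -> q - r] reduces to [r <= q / 2], where [chord_ge] applies. *)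
Lemma chord_rational_ge (R : realType) (q r : nat) : (0 < r < q)%N ->
  2 * ((minn r (q - r))%:R / q%:R) <= chord (r%:R / q%:R : R).
Proof.
wlog rq : r / (r.*2 <= q)%N => [h|] /andP[r0 rltq].
  have [rq|rq] := leqP r.*2 q; first by apply: h; rewrite ?r0.
  have rE : ((q - (q - r)) = r)%N by rewrite subKn// ltnW.
  have qR : q%:R != 0 :> R by rewrite pnatr_eq0 -lt0n (leq_ltn_trans _ rltq).
  have /h : ((q - r).*2 <= q)%N by rewrite doubleB leq_subLR -addnn leq_add2r ltnW.
  rewrite rE subn_gt0 rltq ltn_subrL r0 (leq_ltn_trans _ rltq)// => /(_ isT).
  rewrite minnC; congr (_ <= _).
  rewrite -[RHS]chordN -[RHS](chord_addn _ 1); congr chord.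
  by rewrite natrB 1?ltnW//; field.
have r0R : 0 < r%:R :> R by rewrite ltr0n.
have qR : 0 < q%:R :> R by rewrite ltr0n (leq_ltn_trans _ rltq).
have rqR : 0 < r%:R / q%:R :> R by rewrite divr_gt0.
have -> : minn r (q - r) = r by apply/minn_idPl; rewrite leq_subRL ?addnn// ltnW.
have := @chord_ge R (r%:R / q%:R); rewrite (gtr0_norm rqR); apply.
rewrite ler_pdivrMr//.
by rewrite mulrC ler_pdivlMr// -natrM ler_nat muln2.
Qed.

(** Bounding the reciprocal of a minimum by the sum of both reciprocals lets the sum over [r] split
    into two harmonic sums. *)
Lemma inv_chord_le (R : realType) (q r : nat) : (0 < r < q)%N ->
  (chord (r%:R / q%:R : R))^-1 <= q%:R / 2 * (r%:R^-1 + (q - r)%:R^-1).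
Proof.
move=> rq; have /andP[r0 rltq] := rq.
have qR : 0 < q%:R :> R by rewrite ltr0n (leq_ltn_trans _ rltq).
set m := minn r (q - r).
have m0 : 0 < m%:R :> R by rewrite ltr0n leq_min r0 subn_gt0.
have mqR : 0 < 2 * (m%:R / q%:R) :> R by rewrite mulr_gt0// divr_gt0.
have h := chord_rational_ge R rq.
apply: (@le_trans _ _ (q%:R / 2 * m%:R^-1)).
  have -> : q%:R / 2 * m%:R^-1 = (2 * (m%:R / q%:R))^-1 :> R.
    by field; rewrite !gt_eqF.
  by rewrite lef_pV2// posrE (lt_le_trans mqR).
rewrite ler_wpM2l ?divr_ge0//.
by rewrite /m; case: leqP => _; rewrite ?lerDl ?lerDr invr_ge0.
Qed.

Lemma sum_inv_chord_lt (R : realType) (q : nat) :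
  \sum_(0 <= r < q) (chord (r%:R / q%:R : R))^-1 <= q%:R * harmonic_sum q.
Proof.
case: q => [|q]; first by rewrite big_nil mul0r.
(* The term [r = 0] is the inverse of 0, hence 0. *)
rewrite big_ltn// mul0r chordE mulr0 sin0 normr0 mulr0 invr0 add0r.
apply: (@le_trans _ _ (\sum_(1 <= r < q.+1) q.+1%:R / 2 * (r%:R^-1 + (q.+1 - r)%:R^-1))).
  by rewrite !big_nat; apply: ler_sum => r /andP[r0 rq]; apply: inv_chord_le; rewrite r0.
(* The reversal [r -> q.+1 - r] identifies the second sum with the first. *)
rewrite -mulr_sumr big_split /= [X in _ + X]big_nat_rev /=.
have -> : \sum_(1 <= i < q.+1) (q.+1 - (1 + q.+1 - i.+1))%:R^-1
          = \sum_(1 <= i < q.+1) i%:R^-1 :> R.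
  apply: eq_big_nat => i /andP[i0 iq]; rewrite add1n subSS subKn//.
  exact: ltnW.
have h := @le_harmonic_sum R q q.+1 (leqnSn q).
have q0 : 0 <= q.+1%:R :> R by [].
rewrite -/(harmonic_sum q); nra.
Qed.

Lemma chord_modn (R : realType) (q n : nat) :
  chord (n%:R / q%:R : R) = chord ((n %% q)%:R / q%:R).
Proof.
case: q => [|q]; first by rewrite !invr0 !mulr0.
rewrite {1}(divn_eq n q.+1) natrD natrM mulrDl mulfK// addrC.
exact: chord_addn.
Qed.

(** As [b] is invertible modulo [q], the map [d -> d * b] permutes the residues, and the sum becomes
    the one over all [r / q]. *)
Lemma sum_inv_chord_period (R : realType) (q b : nat) : coprime b q ->
  \sum_(0 <= d < q) (chord (d%:R * (b%:R / q%:R) : R))^-1 <= q%:R * harmonic_sum q.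
Proof.
case: q => [|q] bq; first by rewrite big_nil mul0r.
apply: le_trans (sum_inv_chord_lt R q.+1); rewrite !big_mkord.
pose mul (i : 'I_q.+1) := inord ((i * b) %% q.+1) : 'I_q.+1.
have mulE i : val (mul i) = ((i * b) %% q.+1)%N by rewrite /= inordK// ltn_mod.
have mul_inj : injective mul.
  move=> i j /(congr1 val); rewrite !mulE => /eqP.
  wlog ij : i j / (i <= j)%N => [h|].
    by have [/h//|/ltnW ji] := leqP i j; rewrite eq_sym => /(h _ _ ji) ->.
  (* Equal residues mean that the modulus divides [(j - i) * b], hence [j - i], which is smaller
     than the modulus and so is 0. *)
  rewrite eq_sym eqn_mod_dvd ?leq_mul2r ?ij ?orbT// -mulnBl Gauss_dvdl; last first.
    by rewrite coprime_sym.
  have := ltn_ord j; case: (posnP (j - i)) => [/eqP|ji jq /(dvdn_leq ji)].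
    by rewrite subn_eq0 => ji _ _; apply/val_inj/eqP; rewrite eqn_leq ij.
  by rewrite leqNgt (leq_ltn_trans (leq_subr _ _) jq).
rewrite [leRHS](reindex_inj mul_inj) /=.
apply: ler_sum => i _; rewrite -/(val (mul i)) mulE -chord_modn natrM mulrA.
exact: lexx.
Qed.

(* The terms with [q %| d] vanish, since [0^-1 = 0]. *)
Lemma sum_inv_chord_le (R : realType) (q b D : nat) : coprime b q -> (0 < q)%N ->
  \sum_(1 <= d < D.+1) (chord (d%:R * (b%:R / q%:R) : R))^-1
  <= (D + q)%:R * harmonic_sum q.
Proof.
move=> bq q0; pose h d : R := (chord (d%:R * (b%:R / q%:R) : R))^-1.
have h0 d : 0 <= h d by rewrite invr_ge0 chord_ge0.
have hD d : h (q + d)%N = h d.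
  rewrite /h natrD mulrDl [q%:R * _]mulrC divfK ?pnatr_eq0 -?lt0n// addrC.
  by rewrite chord_addn.
have blocks B : \sum_(0 <= d < B * q) h d = B%:R * \sum_(0 <= d < q) h d.
  elim: B => [|B IH]; first by rewrite big_nil mul0r.
  rewrite mulSn (@big_cat_nat _ _ _ q) ?leq_addr//=.
  rewrite -{2}[q]add0n big_addn addKn -natr1 mulrDl mul1r addrC -IH.
  congr (_ + _); apply: eq_bigr => d _.
  by rewrite addnC hD.
(* The range is covered by [D %/ q + 1] full periods, of total length at most [D + q]. *)
apply: (@le_trans _ _ (\sum_(0 <= d < (D %/ q).+1 * q) h d)).
  rewrite [leRHS](@big_cat_nat _ _ _ D.+1)//=; last first.
    by rewrite -ltn_divLR// ltnSn.
  rewrite [X in X + _]big_ltn// -addrA addrCA lerDl.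
  by rewrite addr_ge0// sumr_ge0.
rewrite blocks; apply: (@le_trans _ _ ((D %/ q).+1%:R * (q%:R * harmonic_sum q))).
  by rewrite ler_wpM2l// sum_inv_chord_period.
rewrite mulrA -natrM ler_wpM2r ?harmonic_sum_ge0// ler_nat mulSn addnC.
by rewrite leq_add2r leq_divM.
Qed.

(* Comparable to [min(N, 1/|t|)], but with a square that integrates to an
   arctangent. *)
Definition peak {R : realType} (N : nat) (t : R) : R :=
  Num.sqrt (2 * N%:R ^+ 2 / (1 + (N%:R * t) ^+ 2)).

(** The two bounds on [x] give [x^2 (1 + N^2 t^2) <= N^2 + N^2], which explains the factor 2 in
    [peak]. *)
Lemma le_peak (R : realType) (N : nat) (t x : R) :
  0 <= x -> x <= N%:R -> x * `|t| <= 1 -> x <= peak N t.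
Proof.
move=> x0 xN xt; rewrite -(ger0_norm x0) -sqrtr_sqr ler_wsqrtr//.
have d0 : 0 < 1 + (N%:R * t) ^+ 2 by rewrite ltr_pwDl// sqr_ge0.
rewrite ler_pdivlMr// exprMn -(real_normK (num_real t)).
have h1 : x ^+ 2 <= N%:R ^+ 2 by rewrite lerXn2r ?nnegrE.
have h2 : (x * `|t|) ^+ 2 <= 1 by rewrite expr_le1// mulr_ge0.
rewrite exprMn in h2; have := sqr_ge0 (N%:R : R).
set u := N%:R ^+ 2 in h1 *; set v := `|t| ^+ 2 in h2 *; set w := x ^+ 2 in h1 h2 *.
move=> u0; have : u * (w * v) <= u * 1 by rewrite ler_wpM2l.
nra.
Qed.

(** * Pointwise upper bounds near a rational *)

(** The hyperbola method leaves two geometric sums for each [d], starting at 1 and at [D.+1]. The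
    free start [k] lets one bound [B d] serve both, whence the factor 2. *)
Lemma cabs_M_le (R : realType) (a : R) (D N : nat) (B : nat -> R) :
  (D <= N)%N -> (N < D.+1 ^ 2)%N ->
  (forall d k, (0 < d <= D)%N -> (0 < k)%N ->
     cabs (\sum_(k <= m < (N %/ d).+1) e (m%:R * (d%:R * a))) <= B d) ->
  cabs (\sum_(1 <= n < N.+1) (tau n)%:R * e (n%:R * a))
  <= 2 * \sum_(1 <= d < D.+1) B d.
Proof.
move=> DN ND hB; rewrite (sum_tau (fun n => e (n%:R * a))).
rewrite (hyperbola (fun n => e (n%:R * a)) DN ND).
apply: le_trans (cabs_sum _ _ _) _; rewrite mulr_sumr !big_nat.
apply: ler_sum => d /andP[d0 dD]; rewrite mulr_natl mulr2n.
have E m : e ((d * m)%N%:R * a) = e (m%:R * (d%:R * a)).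
  by rewrite natrM mulrCA mulrA.
under eq_bigr do rewrite E; under [X in _ + X]eq_bigr do rewrite E.
apply: le_trans (cabsD _ _) _.
by apply: lerD; apply: hB => //; rewrite d0 -ltnS.
Qed.

Lemma cabs_M_le_near_rational (R : realType) (a : R) (D N q b : nat) :
  (0 < D)%N -> (D <= N)%N -> (N < D.+1 ^ 2)%N ->
  (0 < q <= 16 * D)%N -> coprime b q ->
  `|a - b%:R / q%:R| <= (q%:R * (16 * D)%:R)^-1 ->
  cabs (\sum_(1 <= n < N.+1) (tau n)%:R * e (n%:R * a))
  <= 2 * harmonic_sum (16 * D) * (peak N (a - b%:R / q%:R) / q%:R + 68 * D%:R).
Proof.
move=> D0 DN ND /andP[q0 qD] bq; set t := a - _ => tle.
have q0R : 0 < q%:R :> R by rewrite ltr0n.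
have D0R : 0 < D%:R :> R by rewrite ltr0n.
(* The 4 arises because a geometric sum is at most 2 over its chord, and passing from [d * b / q] to
   [d * a] at worst halves the chord. *)
pose B d : R := (if (q %| d)%N then peak N t / d%:R else 0)
                + 4 * (chord (d%:R * (b%:R / q%:R)))^-1.
have c0 d : 0 <= 4 * (chord (d%:R * (b%:R / q%:R)))^-1 :> R.
  by rewrite mulr_ge0// invr_ge0 chord_ge0.
apply: (@le_trans _ _ (2 * \sum_(1 <= d < D.+1) B d)).
  apply: cabs_M_le => // d k /andP[d0 dD] k0; rewrite /B.
  set s := \sum_(_ <= _ < _) _.
  have d0R : 0 < d%:R :> R by rewrite ltr0n.
  (* The 16 is twice the 8 of [chord_le], so that [chord (d * t) <= 1 / (2 q)]. *)
  have dt : 16 * (d%:R * `|t|) <= q%:R^-1.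
    apply: (@le_trans _ _ (16 * (D%:R * (q%:R * (16 * D)%:R)^-1))).
      by rewrite ler_wpM2l// ler_pM// ler_nat.
    by rewrite natrM le_eqVlt; apply/orP; left; apply/eqP; field; rewrite !gt_eqF.
  have aE : d%:R * a = d%:R * (b%:R / q%:R) + d%:R * t by rewrite /t; ring.
  have [qd|qd] := boolP (q %| d)%N.
    apply: (@le_trans _ _ (peak N t / d%:R)); last by rewrite lerDl.
    (* Here [x] is [|s| * d]. It is at most [N] because [k >= 1] leaves at most [N %/ d] terms, and
       [x |t| <= 1] because the chord is at least [2 d |t|]. *)
    rewrite ler_pdivlMr//; apply: le_peak; first by rewrite mulr_ge0 ?cabs_ge0 ?ltW.
      apply: (@le_trans _ _ ((N %/ d)%:R * d%:R)); last first.
        by rewrite -natrM ler_nat leq_divM.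
      apply: (ler_wpM2r (ltW d0R)); apply: le_trans (cabs_geometric_size _ _ _) _.
      by rewrite ler_nat leq_subLR -addn1 addnC leq_add2r.
    have := cabs_geometric_chord (d%:R * a) k (N %/ d).+1; rewrite -/s.
    (* [d * b / q] is an integer. *)
    have -> : chord (d%:R * a) = chord (d%:R * t).
      rewrite aE; have /dvdnP[j ->] := qd.
      rewrite addrC natrM -[X in _ + X]mulrA [q%:R * _]mulrC divfK ?gt_eqF//.
      by rewrite -(natrM _ j b) chord_addn.
    have q1 : q%:R^-1 <= 1 :> R by rewrite invf_le1// ler1n.
    have := @chord_ge R (d%:R * t); rewrite normrM (gtr0_norm d0R).
    have -> : d%:R * `|t| <= 2^-1 by lra.
    move=> /(_ isT) h; have := ler_wpM2l (cabs_ge0 s) h; lra.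
  rewrite add0r.
  have rq : (0 < d %% q < q)%N by rewrite ltn_mod q0 andbT lt0n.
  set c := chord _.
  (* [q] does not divide [d * b], so [d * b / q] is at least [1 / q] away from every integer. *)
  have cge : c >= q%:R^-1.
    rewrite /c.
    have -> : chord (d%:R * (b%:R / q%:R)) = chord (((d * b) %% q)%:R / q%:R) :> R.
      by rewrite mulrA -natrM chord_modn.
    have rbq : (0 < (d * b) %% q < q)%N.
      by rewrite ltn_mod q0 andbT lt0n -/(dvdn q (d * b)) Gauss_dvdl// coprime_sym.
    apply: le_trans (chord_rational_ge _ rbq).
    rewrite mulrA ler_peMl ?invr_ge0 1?ltW//.
    have : 1 <= (minn ((d * b) %% q) (q - (d * b) %% q))%:R :> R.
      by rewrite ler1n leq_min; case/andP: rbq => ->; rewrite subn_gt0.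
    lra.
  have c_gt0 : 0 < c by apply: lt_le_trans cge; rewrite invr_gt0.
  have ca : c / 2 <= chord (d%:R * a).
    have := chord_le_add (d%:R * a) (- (d%:R * t)).
    rewrite {1}aE addrK -/c chordN.
    have := chord_le (d%:R * t); rewrite normrM (gtr0_norm d0R); lra.
  rewrite ler_pdivlMr//.
  have := cabs_geometric_chord (d%:R * a) k (N %/ d).+1; rewrite -/s.
  have := ler_wpM2l (cabs_ge0 s) ca; lra.
rewrite -mulrA ler_wpM2l// big_split /= mulrDr; apply: lerD.
  (* The multiples [d = q * m] contribute [peak / q] times a sum of some of the [1 / m]. *)
  rewrite -big_mkcond sum_multiples//=.
  apply: (@le_trans _ _ (\sum_(1 <= m < D.+1) peak N t / q%:R * m%:R^-1)).
    rewrite big_mkcond; apply: ler_sum => m _; case: ifP => _.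
      by rewrite natrM invfM mulrA.
    by rewrite mulr_ge0 ?invr_ge0 ?ler0n// divr_ge0// sqrtr_ge0.
  rewrite -mulr_sumr mulrC ler_wpM2r ?divr_ge0 ?sqrtr_ge0//.
  by apply: le_harmonic_sum; rewrite leq_pmull.
rewrite -mulr_sumr.
have h1 := sum_inv_chord_le R D bq q0.
(* [q <= 16 * D] gives 17, and the final 68 is [4 * 17]. *)
have h2 : (D + q)%:R <= 17 * D%:R :> R.
  by rewrite -natrM ler_nat mulSn leq_add2l.
have h3 := le_harmonic_sum R qD; have h4 := harmonic_sum_ge0 R q.
set S := \sum_(_ <= _ < _) _ in h1 *; set H := harmonic_sum _ in h1 h3 h4 *.
set H' := harmonic_sum _ in h3 *.
have : (D + q)%:R * H <= 17 * D%:R * H' by apply: ler_pM.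
nra.
Qed.

(** * Estimates for powers and logarithms *)

(** Comparison with the integral of [x^(-s)], through the mean value theorem for [x^(1 - s)] on each
    [[k, k + 1]]; the differences telescope and the total is at most [1 + 1 / (s - 1)]. *)
Lemma powR_sum_le (R : realType) (s : R) (n : nat) : 1 < s ->
  \sum_(1 <= k < n.+1) k%:R `^ (- s) <= s / (s - 1).
Proof.
move=> s1.
have step k : (0 < k)%N ->
    k.+1%:R `^ (- s) <= (s - 1)^-1 * (k%:R `^ (1 - s) - k.+1%:R `^ (1 - s)).
  move=> k0; have k0R : 0 < k%:R :> R by rewrite ltr0n.
  have der (x : R) : x \in `](k%:R : R), k.+1%:R[ ->
      is_derive x 1 (@powR R ^~ (1 - s)) ((1 - s) * x `^ (1 - s - 1)).
    rewrite in_itv /= => /andP[kx _].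
    by apply: is_derive1_powR; exact: lt_trans kx.
  have cont : {within `[(k%:R : R), k.+1%:R], continuous (@powR R ^~ (1 - s))}.
    apply: derivable_within_continuous => x.
    rewrite in_itv /= => /andP[kx _].
    have h : 0 < x by exact: lt_le_trans kx.
    exact: (@ex_derive _ _ _ _ _ _ _ (is_derive1_powR (1 - s) h)).
  have kk : (k%:R : R) <= k.+1%:R by rewrite ler_nat.
  have [c] := MVT_segment kk der cont.
  rewrite in_itv /= => /andP[kc ck] E.
  have {}E : k.+1%:R `^ (1 - s) - k%:R `^ (1 - s) = (1 - s) * c `^ (- s).
    rewrite E (_ : k.+1%:R - k%:R = 1) ?mulr1; last by rewrite -natr1; ring.
    by congr (_ * _ `^ _); ring.
  have -> : k%:R `^ (1 - s) - k.+1%:R `^ (1 - s) = (s - 1) * c `^ (- s).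
    rewrite -opprB E; ring.
  rewrite mulKf ?subr_eq0 ?gt_eqF// !powRN lef_pV2 ?posrE ?powR_gt0//.
    by apply: ge0_ler_powR; rewrite ?nnegrE//; lra.
  exact: lt_le_trans kc.
have -> : s / (s - 1) = 1 + (s - 1)^-1 by field; lra.
have [->|n0] := posnP n; first by rewrite big_geq// addr_ge0// invr_ge0; lra.
rewrite big_ltn// powR1 lerD2l.
apply: (@le_trans _ _ (\sum_(1 <= k < n) (s - 1)^-1 * (k%:R `^ (1 - s) - k.+1%:R `^ (1 - s)))).
  rewrite big_add1 /= !big_nat; apply: ler_sum => k /andP[k0 _]; exact: step.
rewrite -mulr_sumr.
under eq_bigr do rewrite -opprB.
rewrite sumrN (telescope_sumr (fun k => k%:R `^ (1 - s)))// opprB powR1.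
by rewrite ler_piMr ?invr_ge0 ?lerBlDr ?lerDl ?powR_ge0//; lra.
Qed.

(** Each increment is controlled by [ln (1 + x) <= x] at [x = 1 / (n + 1)]. *)
Lemma ln_le_harmonic_sum (R : realType) (n : nat) :
  ln n.+1%:R <= harmonic_sum n :> R.
Proof.
elim: n => [|n IH]; first by rewrite ln1 harmonic_sum_ge0.
rewrite /harmonic_sum big_nat_recr//= -/(harmonic_sum n).
have n1 : 0 < n.+1%:R :> R by rewrite ltr0n.
have -> : n.+2%:R = n.+1%:R * (1 + n.+1%:R^-1) :> R.
  by rewrite -natr1; field; rewrite gt_eqF.
rewrite lnM ?posrE ?addr_gt0 ?invr_gt0//; apply: lerD => //.
by apply: le_ln1Dx; rewrite (lt_trans _ (_ : 0 < _))// invr_gt0.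
Qed.

(** The inequality [ln (1 + x) <= x] at the negative [x = - 1 / (n + 2)] bounds each new term by a
    difference of logarithms. *)
Lemma harmonic_sum_le_ln (R : realType) (n : nat) : (0 < n)%N ->
  harmonic_sum n <= 1 + ln n%:R :> R.
Proof.
elim: n => // -[|n] IH _.
  by rewrite /harmonic_sum big_nat1 ln1 invr1 addr0.
rewrite /harmonic_sum big_nat_recr//= -/(harmonic_sum n.+1).
have n1 : 0 < n.+1%:R :> R by rewrite ltr0n.
have n2 : 0 < n.+2%:R :> R by rewrite ltr0n.
have := IH isT.
have : ln (1 - n.+2%:R^-1) <= - n.+2%:R^-1 :> R.
  by apply: le_ln1Dx; rewrite ltrN2 invf_lt1// ltr1n.
have -> : 1 - n.+2%:R^-1 = n.+1%:R / n.+2%:R :> R.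
  by rewrite -[in n.+1%:R](addrK 1 n.+1%:R) natr1 mulrBl divff ?gt_eqF// mul1r.
rewrite ln_div ?posrE//.
by move: (ln n.+1%:R) (ln n.+2%:R) (n.+2%:R^-1) => u v w; lra.
Qed.

(** [x + y] is at most twice the larger term; the crude constant is harmless since implied constants
    may depend on [p]. *)
Lemma powRD_le (R : realType) (p x y : R) : 0 <= p -> 0 <= x -> 0 <= y ->
  (x + y) `^ p <= 2 `^ p * (x `^ p + y `^ p).
Proof.
move=> p0; wlog xy : x y / x <= y => [h x0 y0|x0 y0].
  have [xy|/ltW xy] := leP x y; first exact: h.
  by rewrite addrC [X in _ * X]addrC; apply: h.
apply: (@le_trans _ _ ((2 * y) `^ p)).
  by apply: ge0_ler_powR => //; rewrite ?nnegrE ?addr_ge0 ?mulr_ge0//; lra.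
by rewrite powRM// ler_wpM2l ?powR_ge0// lerDr powR_ge0.
Qed.

(** All but two of the [p] powers are spent on [peak N t <= 2 * N]; the remaining square is the
    kernel with an arctangent primitive. *)
Lemma peak_powR_le (R : realType) (p t : R) (N : nat) : 2 <= p ->
  peak N t `^ p <= (2 * N%:R) `^ (p - 2) * (2 * N%:R ^+ 2 * (1 + (N%:R * t) ^+ 2)^-1).
Proof.
move=> p2; have d0 : 0 < 1 + (N%:R * t) ^+ 2 by rewrite ltr_pwDl// sqr_ge0.
have w0 : 0 <= 2 * N%:R ^+ 2 / (1 + (N%:R * t) ^+ 2).
  by rewrite divr_ge0 ?mulr_ge0 ?sqr_ge0// ltW.
have pk0 : 0 <= peak N t by exact: sqrtr_ge0.
have [pk|pk] := eqVneq (peak N t) 0.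
  by rewrite pk powR0 ?(mulr_ge0 (powR_ge0 _ _) w0)// gt_eqF//; lra.
have -> : p = (p - 2) + 2%:R by ring.
rewrite powRD ?pk ?implybT// powR_mulrn// addrK.
rewrite {2}/peak sqr_sqrtr//; apply: ler_wpM2r => //.
apply: ge0_ler_powR; rewrite ?nnegrE ?mulr_ge0//; first lra.
rewrite -(ler_pXn2r (n := 2)) ?nnegrE ?mulr_ge0// sqr_sqrtr//.
rewrite ler_pdivrMr// exprMn.
have := sqr_ge0 (N%:R : R); have := sqr_ge0 (N%:R * t).
set u := N%:R ^+ 2; set v := (_ * t) ^+ 2; nra.
Qed.

(** * Lower bound near the origin *)

(** The sum of [tau] is the sum of [N %/ d] over [d <= N], and [N %/ d >= N / (2 d)] because the
    quotient is at least 1. *)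
Lemma sum_tau_ge (R : realType) (N : nat) :
  N%:R / 2 * harmonic_sum N <= \sum_(1 <= n < N.+1) (tau n)%:R :> R.
Proof.
under [leRHS]eq_bigr do rewrite -[(tau _)%:R]mulr1.
rewrite (sum_tau (fun=> 1 : R)) mulr_sumr !big_nat.
apply: ler_sum => d /andP[d0 dN]; rewrite (sum_pairs_le (fun=> 1 : R))//.
rewrite sumr_const_nat subSS subn0 -[leRHS]/((N %/ d)%:R).
have d0R : 0 < d%:R :> R by rewrite ltr0n.
rewrite mulrAC ler_pdivrMr// ler_pdivrMr// -!natrM ler_nat.
have h : (0 < N %/ d)%N by rewrite divn_gt0.
have := ltn_ceil N d0; nia.
Qed.

(** Each [e (n a)] is within [8 n a <= 1 / 2] of 1, so the exponential sum differs from the sum of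
    [tau] by at most half of the latter. *)
Lemma cabs_M_ge (R : realType) (a : R) (N : nat) : 0 <= a -> 16 * N%:R * a <= 1 ->
  (\sum_(1 <= n < N.+1) (tau n)%:R) / 2
  <= cabs (\sum_(1 <= n < N.+1) (tau n)%:R * e (n%:R * a)).
Proof.
move=> a0 aN; set S := \sum_(_ <= _ < _) _; set M := \sum_(_ <= _ < _) _.
have SE : S = cabs (\sum_(1 <= n < N.+1) (tau n)%:R : R[i]).
  by rewrite -natr_sum cabs_nat natr_sum.
have : cabs (\sum_(1 <= n < N.+1) (tau n)%:R - M) <= S / 2.
  rewrite /M -sumrB; apply: le_trans (cabs_sum _ _ _) _.
  rewrite /S mulr_suml !big_nat; apply: ler_sum => n /andP[n0 nN].
  rewrite -[X in X - _]mulr1 -mulrBr cabsM cabs_nat ler_wpM2l//.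
  rewrite -cabsN opprB; apply: le_trans (chord_le _) _.
  rewrite ger0_norm ?mulr_ge0//.
  have : n%:R * a <= N%:R * a by rewrite ler_wpM2r// ler_nat.
  lra.
have := cabsD (\sum_(1 <= n < N.+1) (tau n)%:R - M) M.
rewrite subrK -SE; lra.
Qed.

(** * Measurability and integration *)

(** Separating real and imaginary parts reduces measurability to real trigonometric sums. *)
Lemma sum_nat_e (R : realType) (I : Type) (s : seq I) (c : I -> nat) (x : I -> R) :
  \sum_(i <- s) (c i)%:R * e (x i)
  = ((\sum_(i <- s) (c i)%:R * cos (2 * pi * x i))
     +i* (\sum_(i <- s) (c i)%:R * sin (2 * pi * x i)))%C.
Proof.
elim: s => [|i s IH]; first by rewrite !big_nil.
rewrite !big_cons IH -(rmorph_nat (real_complex R)) /e.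
by apply/eqP; rewrite eq_complex /= !mul0r subr0 addr0 !eqxx.
Qed.

Lemma measurable_cabs_sum_e (R : realType) (s : seq nat) (c : nat -> nat) :
  measurable_fun [set: R] (fun a : R => cabs (\sum_(n <- s) (c n)%:R * e (n%:R * a))).
Proof.
under eq_fun do rewrite sum_nat_e /cabs /=.
have trig (f : R -> R) : continuous f ->
    measurable_fun [set: R] (fun a : R => \sum_(n <- s) (c n)%:R * f (2 * pi * (n%:R * a))).
  move=> cf; apply: measurable_sum => n; apply: measurable_funM => //.
  apply: (measurableT_comp (continuous_measurable_fun cf)).
  by apply: measurable_funM => //; apply: measurable_funM.
apply: (measurableT_comp (continuous_measurable_fun (@sqrt_continuous R))).
by apply: measurable_funD; apply: measurable_funX; apply: trig;
  [exact: continuous_cos|exact: continuous_sin].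
Qed.

Lemma continuous_kernel (R : realType) (N c : R) :
  continuous (fun a : R => (1 + (N * (a - c)) ^+ 2)^-1).
Proof.
move=> a; apply: cvgV; first by rewrite gt_eqF// ltr_pwDl// sqr_ge0.
apply: cvgD; first exact: cvg_cst.
apply: (@continuous_comp _ _ _ (fun a : R => N * (a - c)) (fun x : R => x ^+ 2)).
  apply: cvgM; first exact: cvg_cst.
  by apply: cvgB; [exact: cvg_id|exact: cvg_cst].
exact: exprn_continuous.
Qed.

(** The primitive [atan (N (a - c)) / N] varies by at most [pi / N], and [pi <= 4]; the bound is
    uniform in the centre [c]. *)
Lemma integral_kernel_le (R : realType) (N c : R) : 0 < N ->
  (\int[lebesgue_measure]_(a in `[0%R, 1%R]) ((1 + (N * (a - c)) ^+ 2)^-1)%:E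
   <= (4 / N)%:E)%E.
Proof.
move=> N0; pose F (a : R) := N^-1 * atan (N * (a - c)).
have dF (a : R) : is_derive a 1 F ((1 + (N * (a - c)) ^+ 2)^-1).
  have dl : is_derive a 1 (fun a : R => N * (a - c)) N.
    by apply: is_derive_eq; rewrite subr0 -[_ *: _]/(_ * _) mulr1.
  have dc := @is_derive1_comp R atan (fun a : R => N * (a - c)) a _ _
    (is_derive1_atan _) dl.
  have := @is_deriveZ _ _ _ _ N^-1 _ _ _ dc.
  set d := _ *: _; have -> : d = (1 + (N * (a - c)) ^+ 2)^-1.
    by rewrite /d -[_ *: _]/(_ * _) mulrCA mulVf ?mulr1 ?gt_eqF.
  exact.
have cF : continuous F.
  by move=> a; apply: differentiable_continuous; apply/derivable1_diffP; exact: ex_derive.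
rewrite (@continuous_FTC2 _ _ F)//.
- rewrite -EFinB lee_fin /F -mulrBr mulrC ler_wpM2r ?invr_ge0 1?ltW//.
  have := atan_ltpi2 (N * (1 - c)); have := atan_gtNpi2 (N * (0 - c)).
  have := pi_le4 R; lra.
- exact/continuous_withinT/continuous_kernel.
- split; first by move=> x _; exact: ex_derive.
    by apply: cvg_at_right_filter; exact: cF.
  by apply: cvg_at_left_filter; exact: cF.
- by move=> x _; rewrite derive1E derive_val.
Qed.

Lemma ler_term_sum (R : numDomainType) (F : nat -> R) (m n i : nat) :
  (m <= i < n)%N -> (forall j, 0 <= F j) -> F i <= \sum_(m <= j < n) F j.
Proof.
move=> imn F0; rewrite (bigD1_seq i) ?mem_index_iota ?iota_uniq//= lerDl.
exact: sumr_ge0.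
Qed.

(** The Dirichlet fraction [b / q] varies with [a]. Since all terms are nonnegative, the sum over
    all pairs dominates the one that occurs, and the majorant is an explicit function of [a]. *)
Lemma cabs_M_powR_le (R : realType) (p a : R) (D N : nat) : 2 <= p ->
  0 <= a <= 1 -> (0 < D)%N -> (D <= N)%N -> (N < D.+1 ^ 2)%N ->
  cabs (\sum_(1 <= n < N.+1) (tau n)%:R * e (n%:R * a)) `^ p
  <= (4 * harmonic_sum (16 * D)) `^ p *
     (\sum_(1 <= q < (16 * D).+1) \sum_(0 <= b < q.+1)
        q%:R `^ (- p) * ((2 * N%:R) `^ (p - 2) * (2 * N%:R ^+ 2)) *
        (1 + (N%:R * (a - b%:R / q%:R)) ^+ 2)^-1
      + (68 * D%:R) `^ p).
Proof.
move=> p2 a01 D0 DN ND; have p0 : 0 <= p by lra.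
have K0 : (0 < 16 * D)%N by rewrite muln_gt0.
have [q [b [qK bq cop close]]] := dirichlet_approximation K0 a01.
have := cabs_M_le_near_rational D0 DN ND qK cop close.
set M := cabs _; set H := harmonic_sum _; set P := peak _ _ => hM.
have H0 : 0 <= H by exact: harmonic_sum_ge0.
have P0 : 0 <= P by exact: sqrtr_ge0.
have Pq0 : 0 <= P / q%:R by rewrite divr_ge0.
have D0R : 0 <= 68 * D%:R :> R by rewrite mulr_ge0.
apply: (@le_trans _ _ ((2 * H * (P / q%:R + 68 * D%:R)) `^ p)).
  by apply: ge0_ler_powR; rewrite ?nnegrE ?cabs_ge0// !mulr_ge0// addr_ge0.
rewrite powRM ?mulr_ge0 ?addr_ge0//.
(* One factor 2 is set aside for the constant of [powRD_le]. *)
have -> : (4 * H) `^ p = (2 * H) `^ p * 2 `^ p.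
  by rewrite -powRM ?mulr_ge0//; congr (_ `^ _); ring.
rewrite -mulrA ler_wpM2l ?powR_ge0//.
apply: le_trans (powRD_le p0 Pq0 D0R) _.
rewrite ler_wpM2l ?powR_ge0// lerD2r.
pose T (i j : nat) : R := i%:R `^ (- p) * ((2 * N%:R) `^ (p - 2) * (2 * N%:R ^+ 2)) *
        (1 + (N%:R * (a - j%:R / i%:R)) ^+ 2)^-1.
have T0 i j : 0 <= T i j.
  rewrite !mulr_ge0 ?powR_ge0 ?sqr_ge0// invr_ge0 addr_ge0// sqr_ge0//.
apply: (@le_trans _ _ (T q b)).
  rewrite powRM ?invr_ge0// -powR_inv1// -powRrM mulN1r mulrC /T -!mulrA.
  rewrite ler_wpM2l ?powR_ge0//.
  by apply: le_trans (peak_powR_le _ _ p2) _; rewrite !mulrA.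
apply: (@le_trans _ _ (\sum_(0 <= j < q.+1) T q j)).
  by apply: ler_term_sum; rewrite ?ltnS.
apply: (@ler_term_sum _ (fun i => \sum_(0 <= j < i.+1) T i j)).
  by rewrite ltnS.
by move=> j; apply: sumr_ge0.
Qed.

Lemma integral_EFin_sum_le (R : realType) (A : set R) (I : Type) (s : seq I)
    (f : I -> R -> R) (B : I -> R) : measurable A ->
  (forall i, measurable_fun [set: R] (f i)) -> (forall i x, 0 <= f i x) ->
  (forall i, (\int[lebesgue_measure]_(x in A) (f i x)%:E <= (B i)%:E)%E) ->
  (\int[lebesgue_measure]_(x in A) (\sum_(i <- s) f i x)%:E
   <= (\sum_(i <- s) B i)%:E)%E.
Proof.
move=> mA mf f0 fB; under eq_integral do rewrite -sumEFin.
rewrite ge0_integral_sum//; first by rewrite -sumEFin; apply: lee_sum => i _.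
  by move=> i; apply/measurable_EFinP; apply: measurable_funTS; exact: mf.
by move=> i x _; rewrite lee_fin.
Qed.

Lemma integral_EFin_scale_le (R : realType) (A : set R) (k : R) (f : R -> R) (B : R) :
  measurable A -> 0 <= k ->
  measurable_fun [set: R] f -> (forall x, 0 <= f x) ->
  (\int[lebesgue_measure]_(x in A) (f x)%:E <= B%:E)%E ->
  (\int[lebesgue_measure]_(x in A) (k * f x)%:E <= (k * B)%:E)%E.
Proof.
move=> mA k0 mf f0 fB; under eq_integral do rewrite EFinM.
rewrite ge0_integralZl_EFin//; first by rewrite EFinM lee_wpmul2l ?lee_fin.
  by move=> x _; rewrite lee_fin.
by apply/measurable_EFinP; exact: measurable_funTS.
Qed.

Lemma integral_cabs_M_le (R : realType) (p : R) (D N : nat) : 2 < p ->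
  (0 < D)%N -> (D <= N)%N -> (N < D.+1 ^ 2)%N ->
  (\int[lebesgue_measure]_(a in `[0%R, 1%R])
     (cabs (\sum_(1 <= n < N.+1) (tau n)%:R * e (n%:R * a)) `^ p)%:E
   <= ((4 * harmonic_sum (16 * D)) `^ p *
       (16 * 2 `^ (p - 2) * ((p - 1) / (p - 2)) * N%:R `^ (p - 1)
        + (68 * D%:R) `^ p))%:E)%E.
Proof.
move=> p2 D0 DN ND.
have N0 : 0 < N%:R :> R by rewrite ltr0n (leq_trans D0).
pose T (i j : nat) (a : R) : R :=
  i%:R `^ (- p) * ((2 * N%:R) `^ (p - 2) * (2 * N%:R ^+ 2)) *
  (1 + (N%:R * (a - j%:R / i%:R)) ^+ 2)^-1.
have k0 (c a : R) : 0 <= (1 + (N%:R * (a - c)) ^+ 2)^-1.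
  by rewrite invr_ge0 addr_ge0// sqr_ge0.
have c0 i : 0 <= i%:R `^ (- p) * ((2 * N%:R) `^ (p - 2) * (2 * N%:R ^+ 2)) :> R.
  by rewrite !mulr_ge0 ?powR_ge0 ?sqr_ge0.
have T0 i j a : 0 <= T i j a by rewrite mulr_ge0.
have mT i j : measurable_fun [set: R] (T i j).
  by apply: measurable_funM => //; exact: (continuous_measurable_fun (@continuous_kernel _ _ _)).
have mTT i : measurable_fun [set: R] (fun a => \sum_(0 <= j < i.+1) T i j a).
  by apply: measurable_sum => j.
pose G a := \sum_(1 <= q < (16 * D).+1) \sum_(0 <= b < q.+1) T q b a.
have mG : measurable_fun [set: R] G by apply: measurable_sum => i.
have G0 a : 0 <= G a by apply: sumr_ge0 => i _; apply: sumr_ge0.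
set H := (4 * _) `^ p; set E := (68 * _) `^ p.
apply: (@le_trans _ _ (\int[lebesgue_measure]_(a in `[0%R, 1%R]) (H * (G a + E))%:E)%E).
  apply: ge0_le_integral => //.
  - by move=> a _; rewrite lee_fin powR_ge0.
  - apply/measurable_EFinP; apply: measurable_funTS.
    apply: (@measurableT_comp _ _ _ _ _ _ (@powR R ^~ p)); first exact: measurable_powR.
    exact: measurable_cabs_sum_e.
  - apply/measurable_EFinP; apply: measurable_funTS; apply: measurable_funM => //.
    exact: measurable_funD.
  - move=> a; rewrite /= in_itv /= => a01; rewrite lee_fin.
    by apply: cabs_M_powR_le => //; exact: ltW.
apply: integral_EFin_scale_le => //; first exact: powR_ge0.
- exact: measurable_funD.
- by move=> a; rewrite addr_ge0// powR_ge0.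
under eq_integral do rewrite EFinD.
rewrite ge0_integralD//=; last 3 first.
- by move=> a _; rewrite lee_fin.
- by apply/measurable_EFinP; exact: measurable_funTS.
- by move=> a _; rewrite lee_fin powR_ge0.
rewrite integral_cst//= lebesgue_measure_itv/= lte01 oppr0 adde0 mule1 EFinD.
apply: leeD => //.
have tri q b : (\int[lebesgue_measure]_(a in `[0%R, 1%R]) (T q b a)%:E <=
    (q%:R `^ (- p) * ((2 * N%:R) `^ (p - 2) * (2 * N%:R ^+ 2)) * (4 / N%:R))%:E)%E.
  apply: integral_EFin_scale_le => //; first exact: (continuous_measurable_fun (@continuous_kernel _ _ _)).
  exact: integral_kernel_le.
have trii q := integral_EFin_sum_le (index_iota 0 q.+1) (measurable_itv `[0%R, 1%R])
  (mT q) (T0 q) (tri q).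
have := integral_EFin_sum_le (index_iota 1 (16 * D).+1) (measurable_itv `[0%R, 1%R])
  mTT (fun q a => sumr_ge0 _ (fun b _ => T0 q b a)) trii.
move=> /le_trans; apply; rewrite lee_fin.
under eq_bigr do rewrite sumr_const_nat subn0.
(* This is where [p > 2] is decisive: with [q + 1] numerators for each [q], the series to sum is
   that of [q^(1 - p)]. *)
have s1 : 1 < p - 1 by lra.
have := powR_sum_le (16 * D) s1.
have -> : p - 1 - 1 = p - 2 by ring.
set S := \sum_(_ <= _ < _) _ => hS.
have NE : N%:R `^ (p - 1) = N%:R `^ (p - 2) * N%:R.
  rewrite -[X in _ = _ * X]powRr1 ?ler0n// -powRD ?(gt_eqF N0) ?implybT//.
  by congr (_ `^ _); ring.
apply: (@le_trans _ _ (16 * 2 `^ (p - 2) * S * N%:R `^ (p - 1))); last first.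
  by rewrite ler_wpM2r ?powR_ge0// ler_wpM2l// mulr_ge0// powR_ge0.
rewrite /S mulr_sumr mulr_suml !big_nat; apply: ler_sum => q /andP[q0 _].
rewrite (@powRM _ 2 N%:R)// -(mulr_natr _ q.+1).
have q0R : 0 < q%:R :> R by rewrite ltr0n.
have -> : q%:R `^ (- (p - 1)) = q%:R `^ (- p) * q%:R :> R.
  rewrite -[X in _ = _ * X]powRr1 ?ler0n// -powRD ?(gt_eqF q0R) ?implybT//.
  by congr (_ `^ _); ring.
rewrite NE.
have -> : q%:R `^ (- p) * (2 `^ (p - 2) * N%:R `^ (p - 2) * (2 * N%:R ^+ 2)) *
   (4 / N%:R) * q.+1%:R
  = (8 * q.+1%:R) * (q%:R `^ (- p) * 2 `^ (p - 2) * N%:R `^ (p - 2) * N%:R).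
  by field; rewrite gt_eqF.
have -> : 16 * 2 `^ (p - 2) * (q%:R `^ (- p) * q%:R) * (N%:R `^ (p - 2) * N%:R)
  = (16 * q%:R) * (q%:R `^ (- p) * 2 `^ (p - 2) * N%:R `^ (p - 2) * N%:R).
  by ring.
(* What remains is [8 (q + 1) <= 16 q], true as [q >= 1]. *)
apply: ler_wpM2r; first by rewrite !mulr_ge0 ?powR_ge0.
by rewrite -!natrM ler_nat; lia.
Qed.

(** * The two bounds for the moment *)

(** [ln (1 / 2) <= - 1 / 2] gives [ln 2 >= 1 / 2], so [ln 16 >= 2]. This allows additive constants
    to be absorbed into [ln X]. *)
Lemma ln_ge1 (R : realType) (X : R) : 16 <= X -> 1 <= ln X.
Proof.
move=> hX; have X0 : 0 < X by lra.
have h2 : ln (1 + (- 2^-1)) <= - 2^-1 :> R by apply: le_ln1Dx; lra.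
have E : 1 + (- 2^-1) = 2^-1 :> R by lra.
rewrite E lnV ?posrE// in h2.
apply: (@le_trans _ _ (ln (2 ^+ 4))).
  rewrite lnXn//; move: (ln 2) h2 => u h; rewrite -mulr_natr; lra.
by rewrite ler_ln ?posrE ?exprn_gt0//; lra.
Qed.

Lemma M_tau_upper (R : realType) (p X : R) : 2 < p -> 16 <= X ->
  (\int[lebesgue_measure]_(a in `[0%R, 1%R]) (cabs (M_tau X a) `^ p)%:E
   <= (12 `^ p * (16 * 2 `^ (p - 2) * ((p - 1) / (p - 2)) + 68 `^ p))%:E
      * (X `^ (p - 1) * ln X `^ p)%:E)%E.
Proof.
move=> p2 hX; have X0 : 0 < X by lra.
have L1 := ln_ge1 hX.
have sX0 : 0 <= Num.sqrt X by exact: sqrtr_ge0.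
have sX2 : Num.sqrt X ^+ 2 = X by rewrite sqr_sqrtr// ltW.
have sX1 : 1 <= Num.sqrt X by rewrite -sqrtr1 ler_wsqrtr//; lra.
set N := Num.truncn X; pose D := Num.truncn (Num.sqrt X).
have NX : N%:R <= X by rewrite truncn_le ltW.
have DX : D%:R <= Num.sqrt X by rewrite truncn_le.
have D0 : (0 < D)%N by rewrite truncn_gt0.
(* The integer part of [sqrt X] is also that of the square root of [N], as the hyperbola method
   requires. *)
have DN2 : (D ^ 2 <= N)%N.
  by rewrite truncn_ge_nat ?(ltW X0)// natrX -sX2 lerXn2r ?nnegrE.
have DN : (D <= N)%N by apply: leq_trans DN2; rewrite -mulnn leq_pmulr.
have ND : (N < D.+1 ^ 2)%N.
  rewrite truncn_lt_nat ?(ltW X0)// natrX -sX2 ltrXn2r ?nnegrE//.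
  by rewrite truncnS_gt.
have N0 : 0 < N%:R :> R by rewrite ltr0n (leq_trans D0).
(* [16 * D <= X ^+ 2] bounds the harmonic sum by [1 + 2 ln X]; the 3 turns the earlier factor 4 into
   12. *)
have HL : harmonic_sum (16 * D) <= 3 * ln X.
  apply: le_trans (harmonic_sum_le_ln _ _) _; first by rewrite muln_gt0.
  have : ln (16 * D)%:R <= ln (X ^+ 2) :> R.
    rewrite ler_ln ?posrE ?exprn_gt0 ?ltr0n ?muln_gt0//.
    rewrite natrM expr2 ler_pM//; apply: le_trans DX _.
    by rewrite -[leRHS]sX2 expr2 ler_peMl.
  rewrite lnXn// -mulr_natr; lra.
have H0 := harmonic_sum_ge0 R (16 * D).
apply: le_trans (integral_cabs_M_le p2 D0 DN ND) _.
rewrite -EFinM lee_fin.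
have -> : 12 `^ p * (16 * 2 `^ (p - 2) * ((p - 1) / (p - 2)) + 68 `^ p)
   * (X `^ (p - 1) * ln X `^ p)
   = (12 * ln X) `^ p * (16 * 2 `^ (p - 2) * ((p - 1) / (p - 2)) * X `^ (p - 1)
      + 68 `^ p * X `^ (p - 1)).
  by rewrite powRM//; [ring|lra].
have c0 : 0 <= 16 * 2 `^ (p - 2) * ((p - 1) / (p - 2)) :> R.
  by rewrite !mulr_ge0 ?powR_ge0// ?invr_ge0; lra.
apply: ler_pM; rewrite ?powR_ge0//.
- by rewrite addr_ge0 ?powR_ge0// mulr_ge0 ?powR_ge0.
- by apply: ge0_ler_powR; rewrite ?nnegrE ?mulr_ge0//; lra.
apply: lerD.
  rewrite ler_wpM2l//; apply: ge0_ler_powR; rewrite ?nnegrE ?(ltW X0)//; lra.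
rewrite powRM// ler_wpM2l ?powR_ge0//.
(* [D^p <= X^(p / 2)], and [p / 2 <= p - 1] because [p >= 2]. *)
apply: (@le_trans _ _ (Num.sqrt X `^ p)).
  by apply: ge0_ler_powR; rewrite ?nnegrE//; lra.
rewrite -powR12_sqrt ?(ltW X0)// -powRrM; apply: ler_powR; lra.
Qed.

Lemma M_tau_lower (R : realType) (p X : R) : 2 < p -> 16 <= X ->
  ((X `^ (p - 1) * ln X `^ p)%:E
   <= (16 * 8 `^ p)%:E * \int[lebesgue_measure]_(a in `[0%R, 1%R]) (cabs (M_tau X a) `^ p)%:E)%E.
Proof.
move=> p2 hX; have X0 : 0 < X by lra.
have L1 := ln_ge1 hX.
set N := Num.truncn X.
have NX : N%:R <= X by rewrite truncn_le ltW.
have XN : X < N.+1%:R by rewrite truncnS_gt.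
have XN2 : X / 2 <= N%:R by move: XN; rewrite -natr1; lra.
have tauX : X * ln X / 4 <= \sum_(1 <= n < N.+1) (tau n)%:R.
  apply: le_trans (sum_tau_ge R N).
  have LH : ln X <= harmonic_sum N.
    apply: le_trans (ln_le_harmonic_sum R N).
    by rewrite ler_ln ?posrE ?ltr0n// ltW.
  have -> : X * ln X / 4 = (X / 2) / 2 * ln X by field.
  by apply: ler_pM; lra.
have d0 : 0 < (16 * X)^-1 by rewrite invr_gt0; lra.
have d1 : (16 * X)^-1 <= 1 by rewrite invf_le1; lra.
set f := fun a : R => (cabs (M_tau X a) `^ p)%:E.
have f0 a : (0 <= f a)%E by rewrite lee_fin powR_ge0.
have mf (A : set R) : measurable_fun A f.
  apply/measurable_EFinP; apply: measurable_funTS.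
  apply: (@measurableT_comp _ _ _ _ _ _ (@powR R ^~ p)); first exact: measurable_powR.
  exact: measurable_cabs_sum_e.
(* By nonnegativity the integral may be cut down to the interval of length [1 / (16 X)] on which
   [cabs_M_ge] applies. *)
have sub : (\int[lebesgue_measure]_(a in `[0%R, ((16 * X)^-1)%R]) f a
            <= \int[lebesgue_measure]_(a in `[0%R, 1%R]) f a)%E.
  apply: ge0_subset_integral => //; first exact: mf.
  by move=> a /=; rewrite !in_itv /= => /andP[-> h]; exact: le_trans h d1.
have low : (((X * ln X / 8) `^ p / (16 * X))%R%:E
            <= \int[lebesgue_measure]_(a in `[0%R, ((16 * X)^-1)%R]) f a)%E.
  apply: (@le_trans _ _ (\int[lebesgue_measure]_(a in `[0%R, ((16 * X)^-1)%R])
      (cst ((X * ln X / 8) `^ p)%R%:E a))%E).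
    rewrite integral_cst//= lebesgue_measure_itv/= lte_fin d0 oppr0 adde0.
    by rewrite -EFinM.
  apply: ge0_le_integral => //.
  - by move=> a _; rewrite lee_fin powR_ge0.
  - exact: mf.
  move=> a /=; rewrite in_itv /= => /andP[a0 ad]; rewrite lee_fin.
  have h : X * ln X / 8 <= cabs (M_tau X a).
    apply: le_trans (cabs_M_ge a0 _).
      by move: tauX; move: (X * ln X) => u; lra.
    apply: (@le_trans _ _ (16 * X * (16 * X)^-1)); last by rewrite divff// gt_eqF//; lra.
    by apply: ler_pM => //; rewrite ler_wpM2l.
  have u0 : 0 <= X * ln X / 8 by rewrite !mulr_ge0//; lra.
  by apply: ge0_ler_powR; rewrite ?nnegrE ?cabs_ge0//; lra.
(* The 8 combines the 4 of [tauX] with the half lost in [cabs_M_ge]; the interval length supplies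
   the 16 and lowers [X^p] to [X^(p - 1)]. *)
have E : X `^ (p - 1) * ln X `^ p = (16 * 8 `^ p) * ((X * ln X / 8) `^ p / (16 * X)).
  have l0 : 0 <= ln X by lra.
  rewrite !powRM ?mulr_ge0 ?invr_ge0 ?(ltW X0)//.
  rewrite -(powR_inv1 (_ : 0 <= 8))// -powRrM mulN1r powRN.
  rewrite -(mulr_powRB1 (ltW X0) (_ : 0 < p)); last lra.
  by field; rewrite !gt_eqF ?powR_gt0.
rewrite E EFinM; apply: lee_wpmul2l; last exact: le_trans low sub.
by rewrite lee_fin mulr_ge0 ?powR_ge0.
Qed.

Unset Implicit Arguments.

Theorem theorem1 (R : realType) (p : R) (hp : 2 < p) :
  exists C1 C2 X0 : R, [/\ 0 < C1, 0 < C2, 1 <= X0 &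
    forall X : R, X0 <= X ->
      ((X `^ (p - 1) * ln X `^ p)%:E
         <= C1%:E * \int[lebesgue_measure]_(a in `[0%R, 1%R]) (cabs (M_tau X a) `^ p)%:E)%E
      /\
      (\int[lebesgue_measure]_(a in `[0%R, 1%R]) (cabs (M_tau X a) `^ p)%:E
         <= C2%:E * (X `^ (p - 1) * ln X `^ p)%:E)%E].
Proof.
have cpos : 0 < 12 `^ p * (16 * 2 `^ (p - 2) * ((p - 1) / (p - 2)) + 68 `^ p).
  rewrite mulr_gt0 ?powR_gt0// addr_gt0 ?powR_gt0//.
  by rewrite !mulr_gt0 ?powR_gt0 ?invr_gt0//; lra.
exists (16 * 8 `^ p), (12 `^ p * (16 * 2 `^ (p - 2) * ((p - 1) / (p - 2)) + 68 `^ p)), 16.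
split=> //; first by rewrite ler1n.
by move=> X hX; split; [exact: M_tau_lower|exact: M_tau_upper].
Qed.
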